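(* Let $\kappa$ be an uncountable cardinal with $\mathfrak{par}(\kappa^\omega) = \kappa$. Then the following are equivalent: (1) $\kappa \in \mathfrak{sp}(\text{Borel})$; (2) there is a continuous bijection from $\kappa^\omega$ onto $\mathbb{R}$; (3) there is a continuous bijection from $\kappa^\omega$ onto a compact metric space.
   Context: $\mathfrak{sp}(\text{Borel}) = \{|\mathcal{P}| : \mathcal{P} \text{ is a partition of } \mathbb{R} \text{ into uncountably many Borel sets}\}$. The cardinal $\kappa$ has the discrete topology and $\kappa^\omega$ the product topology. For a topological space $X$, $\mathfrak{par}(X) = \min\{|\mathcal{P}| : \mathcal{P} \text{ is a partition of } X \text{ into Polish subspaces}\}$. *)

(* Defs.v *)
From HB Require Import structures.
From mathcomp Require Import all_boot all_order all_algebra.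
From mathcomp Require Import all_classical all_reals all_analysis.
Set Implicit Arguments.
Unset Strict Implicit.
Unset Printing Implicit Defensive.
Import Order.TTheory GRing.Theory Num.Theory.
Import numFieldNormedType.Exports.
Local Open Scope classical_set_scope.
Local Open Scope card_scope.
Local Open Scope ring_scope.

(* The library packages completeness only for pointed types, through [cvg];
   here the limit is quantified so that no base point is needed. *)
Definition complete_space (M : uniformType) : Prop :=
  forall F : set_system M, ProperFilter F -> cauchy F ->
    exists l : M, F --> l.

Definition homeomorphic (X Y : topologicalType) : Prop :=
  exists (f : X -> Y) (g : Y -> X),
    [/\ cancel f g, cancel g f, continuous f & continuous g].

Definition completely_metrizable (R : realType) (X : topologicalType) : Prop :=
  exists2 M : metricType R, complete_space M & homeomorphic X M.

Definition separable (X : topologicalType) : Prop :=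
  exists2 D : set X, countable D & dense D.

Definition polish (R : realType) (X : topologicalType) : Prop :=
  separable X /\ completely_metrizable R X.

(* The coercion of [A] to [set_type A] carries the subspace topology, unlike
   [subspace A], which is a topology on all of [X]. *)
Definition polish_partition (R : realType) (X : topologicalType)
    (P : set (set X)) : Prop :=
  partition P id [set: X] /\ forall A, P A -> polish R (set_type A).

(* Cardinals are represented by types: [par_eq R X K] says that the minimum
   par(X) exists and is the cardinality of [K]. *)
Definition par_eq (R : realType) (X : topologicalType) (K : Type) : Prop :=
  (exists2 P : set (set X), polish_partition R P & P #= [set: K]) /\
  (forall P : set (set X), polish_partition R P -> [set: K] #<= P).

Definition borel_set (X : topologicalType) : set (set X) := <<s @open X >>.

(* [sp_borel R K] says that the cardinality of [K] belongs to sp(Borel). *)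
Definition sp_borel (R : realType) (K : Type) : Prop :=
  exists P : set (set R),
    [/\ partition P id [set: R], P `<=` @borel_set R, ~ countable P
      & P #= [set: K]].

Notation omega_power K := {ptws nat -> discrete_topology K}.

(* Main.v *)
(** A condensation is a continuous bijection; [K^w] is [omega_power K].

(1) => (2): a Borel subset of [nat^w] is the injective projection of a closed
set [H] of sequences of pairs (the sets for which this holds together with
their complements form a sigma-algebra).  Transport the partition of the line
to a partition of [nat^w] into Borel sets [B k], [k : K], along a condensation
[nat^w -> R], with witnesses [H k].  Splitting a sequence [y] into countably
many sequences [y_i], record with [y] the indices [a_i] such that [y_i] is in
[B a_i] and the witnesses of these memberships: this condenses onto [nat^w] the
branches of a tree in which every node has exactly [K] children, because [a_i]
is unconstrained when it is chosen.  Such a space is homeomorphic to [K^w].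

(2) => (3): the line condenses onto the lemniscate.

(3) => (1): a Polish [A] in [K^w] is a G-delta in its closure, which lies in
[N^w] for a countable [N], so by the Lusin-Souslin argument its image in the
compact space is Borel.  The images of the pieces of a Polish partition are
pulled back to the line along a Borel surjection [R -> nat^w -> 2^w -> M]. *)

Require Import Defs.
From HB Require Import structures.
From mathcomp Require Import all_boot all_order all_algebra.
From mathcomp Require Import all_classical all_reals all_analysis.
From mathcomp Require Import zify lra.
Import Order.TTheory GRing.Theory Num.Theory.
Import numFieldNormedType.Exports.
Set Implicit Arguments.
Unset Strict Implicit.
Unset Printing Implicit Defensive.
Local Open Scope classical_set_scope.
Local Open Scope card_scope.

(** * Trees with a constant number of children *)

Lemma infinite_prod_nat_inj (K : choiceType) :
  infinite_set [set: K] -> exists f : K * nat -> K, injective f.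
Proof.
(* A maximal family of disjoint copies of [nat] in [K] misses finitely many
   points. *)
move=> Kinf.
have extend (E : set (nat -> K)) :
    infinite_set (~` \bigcup_(e in E) range e) ->
    exists2 e : nat -> K, injective e & forall e1 m n, E e1 -> e m <> e1 n.
  move=> /infiniteP; have [k0 _] := infinite_setN0 Kinf.
  pose Kp : pointedType := HB.pack K (isPointed.Build K k0).
  move=> /(@pcard_leP nat Kp)/unsquash e; exists e.
    by move=> m n emn; apply: (@inj _ _ _ e) => //; exact: mem_set.
  move=> e' m n Ee' eE.
  have : (~` \bigcup_(e in E) range e) (e m) by apply: (@funS _ _ _ _ e).
  by apply; exists e' => //; exists n.
have [E [EI Edisj Emax]] := @ex_maximal_disjoint_subcollection
  (nat -> K) K (fun e => range e) [set e : nat -> K | injective e].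
have rem_fin : finite_set (~` \bigcup_(e in E) range e).
  apply: contrapT => /extend [e einj eE].
  apply: (Emax (E `|` [set e])).
  - split=> [|/(_ e (or_intror erefl)) Ee]; first by left.
    exact: (eE e 0%N 0%N).
  - by move=> e' [/EI//|->].
  - move=> e1 e2 [E1|->] [E2|->] // [k [[m _ <-] [n _ mn]]].
    + by apply: Edisj => //; exists (e1 m); split; [exists m|exists n].
    + by case: (eE e1 n m).
    + by case: (eE e2 m n).
have [e0 Ee0] : E !=set0.
  apply/set0P/eqP => E0; apply: Kinf; move: rem_fin.
  by rewrite E0 bigcup_set0 setC0.
(* The leftover points are absorbed into one member [e0] of the family: [C0] is countable and [j]
   codes its points along [e0]; any other point is coded by the copy containing it and its index
   there. *)
pose C0 := range e0 `|` ~` \bigcup_(e in E) range e.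
have [j jinj] : exists j : K -> nat, {in C0 &, injective j}.
  apply/countable_injP; rewrite /C0 -bigcup2E; apply: bigcup_countable => //.
  move=> [|[|i]] _ /=; last exact: countable0.
    exact: card_image_le.
  exact: finite_set_countable.
have code k : exists en : (nat -> K) * nat,
    E en.1 /\ (C0 k -> en = (e0, j k)) /\ (~ C0 k -> en.1 <> e0 /\ en.1 en.2 = k).
  have [C0k|nC0k] := pselect (C0 k); first by exists (e0, j k).
  have : (\bigcup_(e in E) range e) k by apply: contrapT => ?; apply: nC0k; right.
  move=> [e Ee [n _ ek]]; exists (e, n); split=> //; split=> // _; split => //= ee0.
  by apply: nC0k; left; exists n => //; rewrite -ee0.
have /choice[c cP] := code.
have cinj : injective c.
  move=> k l ckl; have [Ek [k1 k2]] := cP k; have [El [l1 l2]] := cP l.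
  have [C0k|nC0k] := pselect (C0 k); have [C0l|nC0l] := pselect (C0 l).
  - by move: ckl; rewrite k1// l1// => -[]; apply: jinj; exact: mem_set.
  - by have [] := l2 nC0l; rewrite -ckl (k1 C0k).
  - by have [] := k2 nC0k; rewrite ckl (l1 C0l).
  - by have [_ <-] := k2 nC0k; have [_ <-] := l2 nC0l; rewrite ckl.
have : [set: nat * nat] #= [set: nat] := card_nat2.
move=> /(@card_set_bijP _ nat)[q qbij].
have qinj : injective q.
  by move=> x y qxy; apply: (set_bij_inj qbij) => //; exact: mem_set.
(* Each copy of [nat] is cut by [q] into countably many copies, one for each point coded in it. *)
exists (fun kn => (c kn.1).1 (q ((c kn.1).2, kn.2))) => -[k m] [l n] /= ckl.
have [Ek _] := cP k; have [El _] := cP l.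
have ekl : (c k).1 = (c l).1.
  apply: Edisj => //; exists ((c k).1 (q ((c k).2, m))); split.
    by exists (q ((c k).2, m)).
  by rewrite ckl; exists (q ((c l).2, n)).
move: ckl; rewrite ekl => /(EI _ El)/qinj [ckl2 ->].
by congr pair; apply: cinj; rewrite [LHS]surjective_pairing ekl ckl2 -surjective_pairing.
Qed.

Definition agree (A : Type) (n : nat) (x y : nat -> A) : Prop :=
  forall i, (i < n)%N -> x i = y i.

(** Closedness in the product of discrete spaces: such an [F] is the set of branches of a tree. *)
Definition seq_closed (A : Type) (F : set (nat -> A)) : Prop :=
  forall x, (forall n, exists2 y, F y & agree n x y) -> F x.

Lemma agree_sym (A : Type) n (x y : nat -> A) : agree n x y -> agree n y x.
Proof. by move=> xy i /xy. Qed.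

Lemma agree_trans (A : Type) n (y x z : nat -> A) :
  agree n x y -> agree n y z -> agree n x z.
Proof. by move=> xy yz i ni; rewrite xy// yz. Qed.

Lemma agree_leq (A : Type) m n (x y : nat -> A) :
  (m <= n)%N -> agree n x y -> agree m x y.
Proof. by move=> mn xy i im; apply: xy; exact: leq_trans mn. Qed.

Lemma agreeS (A : Type) n (x y : nat -> A) :
  agree n x y -> x n = y n -> agree n.+1 x y.
Proof.
by move=> xy xyn i; rewrite ltnS leq_eqVlt => /orP[/eqP->|/xy].
Qed.

Definition children (L : Type) (V : set (nat -> L)) n v : set L :=
  [set w n | w in V `&` agree n v].

Lemma eq_children (L : Type) (V : set (nat -> L)) n v w :
  agree n v w -> children V n v = children V n w.
Proof.
by move=> vw; apply/seteqP; split=> _ [z [Vz az] <-]; exists z => //; split => //;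
  [exact: agree_trans (agree_sym vw) az|exact: agree_trans vw az].
Qed.

(** Given a bijection of [K] with the children of every node, a sequence over [K] is a list of
    choices to follow; the resulting branch stays in [V] by closedness. *)
Lemma tree_body_bij (K L : choiceType) (V : set (nat -> L)) :
  V !=set0 -> seq_closed V ->
  (forall v n, V v -> [set: K] #= children V n v) ->
  exists2 h : (nat -> K) -> (nat -> L), set_bij setT V h &
    forall x y n, agree n x y -> agree n (h x) (h y).
Proof.
move=> [v0 Vv0] Vcl VK.
pose Lp : pointedType := HB.pack L (isPointed.Build L (v0 0%N)).
(* The bijection is chosen for a set of children, not for a node, so sequences that agree below [n]
   use the same one. *)
have /choice[E EP] (C : set L) :
    exists e : K -> L, [set: K] #= C -> set_bij setT C e.
  have [KC|] := pselect ([set: K] #= C); last by exists (fun=> v0 0%N).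
  by move: (KC) => /(@card_set_bijP K Lp)[e eb]; exists e.
have {}EP v n : V v -> set_bij setT (children V n v) (E (children V n v)).
  by move=> /VK /EP.
(* [a x n] has its first [n] entries final and copies [v0] beyond; [h] is the diagonal. *)
pose a x := fix a n : nat -> L := if n is m.+1 then
  fun i => if i == m then E (children V m (a m)) (x m) else a m i else v0.
pose h x n := a x n.+1 n.
have ah x n : agree n (a x n) (h x).
  elim: n => // n IH; apply: agreeS => // i ni /=.
  by rewrite (ltn_eqF ni) IH.
have hE x n : h x n = E (children V n (h x)) (x n).
  by rewrite /h/= eqxx (eq_children V (ah x n)).
have hV x n : exists2 w, V w & agree n (h x) w.
  elim: n => [|n [w Vw hw]]; first by exists v0.
  have [Ef _ _] := EP w n Vw.
  have : children V n w (h x n) by rewrite hE (eq_children V hw); exact: Ef.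
  move=> [z [Vz wz] zn]; exists z => //; apply: agreeS => //.
  exact: agree_trans wz.
have Vh x : V (h x) by exact/Vcl/hV.
exists h.
  split => [x _|x y _ _ hxy|v Vv].
  - exact: Vh.
  - apply/funext => n; have [_ + _] := EP _ n (Vh x); apply; try exact: mem_set.
    by rewrite -hE {2}hxy -hE hxy.
  - have /choice[x xP] n : exists k, E (children V n v) k = v n.
      have [_ _ Es] := EP v n Vv.
      by have [|k _ kE] := Es (v n); [exists v|exists k].
    exists x => //; apply/funext => m.
    suff : agree m.+1 (h x) v by apply.
    elim: m.+1 => // n IH; apply: agreeS => //.
    by rewrite hE (eq_children V IH).
move=> x y; elim=> // n IH xy; apply: agreeS; first by apply: IH; exact: agree_leq xy.
rewrite !hE xy// (@eq_children _ V n (h x) (h y))//.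
by apply: IH; exact: agree_leq xy.
Qed.

(** * Sets of sequences with unique witnesses *)

(** A bijection of pairs with numbers for which the [i]-th subsequence only occupies indices from
    [i] on. *)
Definition pairing (i j : nat) : nat := (2 ^ j * i.*2.+1).-1.

Lemma leq_pairing i j : (i <= pairing i j)%N.
Proof. by rewrite /pairing; have := expn_gt0 2 j; nia. Qed.

Lemma pairing_inj i j i' j' : pairing i j = pairing i' j' -> i = i' /\ j = j'.
Proof.
rewrite /pairing => e; have {}e : (2 ^ j * i.*2.+1 = 2 ^ j' * i'.*2.+1)%N.
  by have := expn_gt0 2 j; have := expn_gt0 2 j'; nia.
elim: j j' e => [|j IH] [|j']; rewrite ?expnS ?expn0; try lia.
move=> e; have /IH[-> ->//] : (2 ^ j * i.*2.+1 = 2 ^ j' * i'.*2.+1)%N by lia.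
Qed.

Lemma pairing_surj n : exists i j, n = pairing i j.
Proof.
suff [i [j e]] : exists i j, n.+1 = (2 ^ j * i.*2.+1)%N.
  by exists i, j; rewrite /pairing -e.
have [m] := ubnP n; elim: m n => // m IH n nm.
case: (boolP (odd n)) => on.
  have [|i [j e]] := IH n./2; first lia.
  by exists i, j.+1; rewrite expnS -mulnA -e; lia.
by exists n./2, 0%N; rewrite expn0; lia.
Qed.

Definition unpair1 n := projT1 (cid (pairing_surj n)).
Definition unpair2 n := projT1 (cid (projT2 (cid (pairing_surj n)))).

Lemma unpairK n : pairing (unpair1 n) (unpair2 n) = n.
Proof. by rewrite -(projT2 (cid (projT2 (cid (pairing_surj n))))). Qed.

Lemma pairingK1 i j : unpair1 (pairing i j) = i.
Proof. by have [] := pairing_inj (unpairK (pairing i j)). Qed.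

Lemma pairingK2 i j : unpair2 (pairing i j) = j.
Proof. by have [] := pairing_inj (unpairK (pairing i j)). Qed.

Definition uniquely_witnessed (B : set (nat -> nat)) : Prop :=
  exists2 H : set (nat -> nat * nat), seq_closed H &
    set_bij H B (fun h => fst \o h).

Lemma eventually_agree (A : Type) (r : nat -> nat) n :
  exists m, forall x y : nat -> A, agree m x y -> agree n (x \o r) (y \o r).
Proof.
exists (\max_(i < n) (r i).+1) => x y xy i ni; apply: xy.
exact: (@leq_bigmax _ (fun i : 'I_n => (r i).+1) (Ordinal ni)).
Qed.

(** The witnesses for all the [B n] are interleaved along [pairing]. *)
Lemma uniquely_witnessed_cap (B : nat -> set (nat -> nat)) :
  (forall n, uniquely_witnessed (B n)) -> uniquely_witnessed (\bigcap_n B n).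
Proof.
move=> Bw; have /all_sig2[H Hcl HB] n := cid2 (Bw n).
pose sl n (h : nat -> nat * nat) j := ((h j).1, (h (pairing n j)).2).
exists [set h : nat -> nat * nat | forall n, H n (sl n h)].
  move=> h hcl n; apply: Hcl => m.
  have [p pP] := eventually_agree (nat * nat) (pairing n) m.
  have [y Hy ay] := hcl (maxn m p); exists (sl n y) => // i im.
  have := pP _ _ (agree_leq (leq_maxr _ _) ay) i im.
  by rewrite /sl /= => ->; rewrite (agree_leq (leq_maxl _ _) ay).
split=> [h hH n _|h h' /set_mem hH /set_mem hH' hh'|y By].
- by have [Hf _ _] := HB n; exact: (Hf (sl n h)).
- have e1 i : (h i).1 = (h' i).1 by have := congr1 (@^~ i) hh'.
  apply/funext => k; rewrite [LHS]surjective_pairing [RHS]surjective_pairing e1.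
  congr pair; rewrite -(unpairK k); set n := unpair1 k.
  have [_ Hi _] := HB n.
  have : sl n h = sl n h'.
    by apply: Hi; [exact/mem_set/hH|exact/mem_set/hH'|exact/funext/e1].
  by move=> /(congr1 (@^~ (unpair2 k)))[].
- have /choice[g gP] n : exists g, H n g /\ fst \o g = y.
    by have [_ _ /(_ y (By n I))[g Hg gy]] := HB n; exists g.
  exists (fun k => (y k, (g (unpair1 k) (unpair2 k)).2)) => // n.
  have [Hg gy] := gP n; congr (H n _): Hg; apply/funext => j.
  by rewrite /sl /= pairingK1 pairingK2 -gy /= -surjective_pairing.
Qed.

(** Disjointness determines the index of the set containing a point, so this index can head the
    witness, the rest being shifted by one place. *)
Lemma uniquely_witnessed_cup (B : nat -> set (nat -> nat)) :
  trivIset setT B ->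
  (forall n, uniquely_witnessed (B n)) -> uniquely_witnessed (\bigcup_n B n).
Proof.
move=> Bdisj Bw; have /all_sig2[H Hcl HB] n := cid2 (Bw n).
pose tl (h : nat -> nat * nat) j := ((h j).1, (h j.+1).2).
exists [set h : nat -> nat * nat | H (h 0%N).2 (tl h)].
  move=> h hcl; apply: Hcl => m; have [y Hy ay] := hcl m.+1.
  exists (tl y); first by rewrite /= (ay 0%N).
  by move=> i im; rewrite /tl !ay// ltnW.
split=> [h hH|h h' /set_mem hH /set_mem hH' hh'|y [n _ By]].
- exists (h 0%N).2 => //.
  by have [Hf _ _] := HB (h 0%N).2; exact: (Hf (tl h)).
- have e1 i : (h i).1 = (h' i).1 by have := congr1 (@^~ i) hh'.
  have e2 : (h 0%N).2 = (h' 0%N).2.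
    apply: Bdisj => //; exists (fst \o h); split.
      by have [Hf _ _] := HB (h 0%N).2; exact: (Hf (tl h)).
    by have [Hf _ _] := HB (h' 0%N).2; rewrite hh'; exact: (Hf (tl h')).
  have : tl h = tl h'.
    have [_ Hi _] := HB (h 0%N).2.
    by apply: Hi; [exact/mem_set|apply: mem_set; rewrite e2|exact/funext/e1].
  move=> tlh; apply/funext => k.
  rewrite [LHS]surjective_pairing [RHS]surjective_pairing e1; congr pair.
  by case: k => // k; have [] := congr1 (@^~ k) tlh.
- have [_ _ /(_ y By)[g Hg gy]] := HB n.
  exists (fun k => (y k, if k is j.+1 then (g j).2 else n)) => //=.
  congr (H n _): Hg; apply/funext => j.
  by rewrite /tl /= -gy /= -surjective_pairing.
Qed.

Lemma uniquely_witnessed_closed (B : set (nat -> nat)) :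
  seq_closed B -> uniquely_witnessed B.
Proof.
move=> Bcl; exists [set h : nat -> nat * nat | B (fst \o h) /\ forall i, (h i).2 = 0%N].
  move=> h hcl; split.
    by apply: Bcl => n; have [y [By _] ay] := hcl n; exists (fst \o y) => // i /ay /= ->.
  by move=> i; have [y [_ y0] ay] := hcl i.+1; rewrite ay.
split=> [h []//|h h' /set_mem [_ h0] /set_mem [_ h0'] hh'|y By].
  apply/funext => k; rewrite [LHS]surjective_pairing [RHS]surjective_pairing.
  by rewrite h0 h0'; have /= -> := congr1 (@^~ k) hh'.
by exists (fun k => (y k, 0%N)).
Qed.

(** A union is first made disjoint, which is why the complements have to be carried along. *)
Lemma sigma_algebra_uniquely_witnessed :
  sigma_algebra setT
    [set B | uniquely_witnessed B /\ uniquely_witnessed (~` B)].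
Proof.
split.
- by split; apply: uniquely_witnessed_closed => //; [move=> x /(_ 0%N)[]|rewrite setC0].
- by move=> A [A1 A2]; rewrite setTD /= setCK.
- move=> B BP; split; last first.
    by rewrite setC_bigcup; apply: uniquely_witnessed_cap => n; exact: (BP n).2.
  rewrite seqDU_bigcup_eq; apply: uniquely_witnessed_cup; first exact: trivIset_seqDU.
  move=> n.
  (* For [k >= n] the factor is [B n] itself, so that the intersection runs over all of [nat]. *)
  rewrite (_ : seqDU B n = \bigcap_k if (k < n)%N then ~` B k else B n).
    by apply: uniquely_witnessed_cap => k; case: ifP => _; [exact: (BP k).2|exact: (BP n).1].
  apply/seteqP; split=> [y [Bn nB] k _|y yB].
    case: ifP => // kn Bk; apply: nB; rewrite -bigcup_mkord; by exists k.
  split; first by have := yB n I; rewrite ltnn.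
  by rewrite -bigcup_mkord => -[k /= kn Bk]; have := yB k I; rewrite kn.
Qed.

(** A label holds the index of a piece, an entry of the interleaved sequence and an entry of a
    witness. The index stored at [i] concerns the [i]-th subsequence, which has no entry before
    position [i]. *)
Lemma partition_seq_bij (K : choiceType) (B : K -> set (nat -> nat)) :
  infinite_set [set: K] -> (forall k, uniquely_witnessed (B k)) ->
  partition [set: K] B setT ->
  exists2 h : (nat -> K) -> (nat -> nat), bijective h &
    forall x y n, agree n x y -> agree n (h x) (h y).
Proof.
move=> Kinf Bw [Bcov Bdisj B0].
have /all_sig2[H Hcl HB] k := cid2 (Bw k).
have H0 k : exists g, H k g.
  by have [y By] := B0 k I; have [_ _ /(_ y By)[g Hg _]] := HB k; exists g.
have [k0 _] := infinite_setN0 Kinf.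
pose L := (K * (nat * nat))%type.
pose V := [set v : nat -> L |
  forall i, H (v i).1 (fun j => (v (pairing i j)).2)].
have [v0 Vv0] : V !=set0.
  have [g Hg] := H0 k0; exists (fun n => (k0, g (unpair2 n))) => i /=.
  by congr (H k0 _): Hg; apply/funext => j; rewrite pairingK2.
have Vcl : seq_closed V.
  move=> v vcl i; apply: Hcl => n.
  have [m mP] := eventually_agree L (pairing i) n.
  have [w Vw vw] := vcl (maxn i.+1 m).
  exists (fun j => (w (pairing i j)).2); first by rewrite vw; [exact: Vw|exact: leq_maxl].
  move=> j jn; congr snd.
  exact: (mP _ _ (agree_leq (leq_maxr _ _) vw)).
have [f finj] := infinite_prod_nat_inj Kinf.
have VK v n : V v -> [set: K] #= children V n v.
  move=> Vv; rewrite card_eq_le; apply/andP; split.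
    rewrite (_ : [set: K] = fst @` children V n v); first exact: card_image_le.
    apply/seteqP; split=> // k _; have [g Hg] := H0 k.
    (* Changing [(v n).1] only affects entries of index [pairing n j >= n]. *)
    pose w m : L := (if m == n then k else (v m).1,
      if unpair1 m == n then g (unpair2 m) else (v m).2).
    exists (w n) => /=; last by rewrite eqxx.
    exists w => //; split.
      move=> i; rewrite /w /=; have [->|ni] := eqVneq i n.
        congr (H k _): Hg; apply/funext => j.
        by rewrite pairingK1 eqxx pairingK2.
      congr (H _ _): (Vv i); apply/funext => j.
      by rewrite pairingK1 (negPf ni).
    move=> i ni; rewrite /w (ltn_eqF ni) ifF; first by rewrite -surjective_pairing.
    apply/negP => /eqP e; have := leq_pairing (unpair1 i) (unpair2 i).
    by rewrite unpairK e leqNgt ni.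
  (* Conversely, labels inject into [K]: two uses of [f] absorb the two numbers of a label. *)
  apply: (@card_le_trans _ _ _ [set: L]); first exact: subset_card_le.
  pose c (l : L) := f (f (l.1, l.2.1), l.2.2).
  have cinj : injective c by move=> [k [a b]] [k' [a' b']] /finj [/finj [-> ->] ->].
  apply: (@card_le_trans _ _ _ (range c)); last exact: subset_card_le.
  have /card_eqPle[_ //] : range c #= [set: L].
  by apply: inj_card_eq => x y _ _; exact: cinj.
have [h hbij hagr] := @tree_body_bij K L V (ex_intro _ v0 Vv0) Vcl VK.
pose p (v : nat -> L) n := (v n).2.1.
exists (p \o h); last by move=> x y n xy i ni /=; rewrite /p (hagr _ _ _ xy).
rewrite -setTT_bijective; split => //.
  move=> x x' _ _ /= pp; have [hV hinj _] := hbij.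
  apply: hinj; [exact: mem_set|exact: mem_set|].
  have Vx := hV x I; have Vx' := hV x' I; move: (h x) (h x') Vx Vx' pp => v w Vv Vw pp.
  have e1 i j : (v (pairing i j)).2.1 = (w (pairing i j)).2.1.
    exact: (congr1 (@^~ (pairing i j)) pp).
  (* Both pieces contain the [i]-th subsequence of the common projection. *)
  have e2 i : (v i).1 = (w i).1.
    apply: Bdisj => //; exists (fun j => (v (pairing i j)).2.1); split.
      by have [Hf _ _] := HB (v i).1; exact: (Hf _ (Vv i)).
    have [Hf _ _] := HB (w i).1; have := Hf _ (Vw i).
    by congr (B _ _); apply/funext => j; rewrite /= e1.
  apply/funext => n; rewrite [LHS]surjective_pairing [RHS]surjective_pairing e2.
  congr pair; rewrite -(unpairK n); set i := unpair1 n.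
  have [_ Hi _] := HB (v i).1.
  have := Hi (fun j => (v (pairing i j)).2) (fun j => (w (pairing i j)).2).
  move=> /(_ (mem_set (Vv i))); rewrite e2 => /(_ (mem_set (Vw i))) e.
  by have /e/(congr1 (@^~ (unpair2 n))) : fst \o (fun j => (v (pairing i j)).2) =
    fst \o (fun j => (w (pairing i j)).2) by exact/funext/e1.
move=> z _.
have /choice[a aP] i : exists k, B k (fun j => z (pairing i j)).
  have : cover [set: K] B (fun j => z (pairing i j)) by rewrite Bcov.
  by move=> [k _ Bk]; exists k.
have /choice[g gP] i : exists g, H (a i) g /\ fst \o g = fun j => z (pairing i j).
  by have [_ _ /(_ _ (aP i))[g Hg gz]] := HB (a i); exists g.
pose v n : L := (a n, g (unpair1 n) (unpair2 n)).
have Vv : V v.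
  move=> i; have [Hg _] := gP i; congr (H _ _): Hg; apply/funext => j.
  by rewrite /v pairingK1 pairingK2.
have [_ _ /(_ v Vv)[x _ xv]] := hbij; exists x => //=.
rewrite xv; apply/funext => n; rewrite /p /v /=.
have [_ /(congr1 (@^~ (unpair2 n))) /= ->] := gP (unpair1 n).
by rewrite unpairK.
Qed.

(** * The topology and the Borel sets of sequence spaces *)

Lemma nbhs_omega_power (K : choiceType) (x : omega_power K) (U : set (omega_power K)) :
  nbhs x U <-> exists n, forall y, agree n x y -> U y.
Proof.
split.
  (* This filter converges in every coordinate, hence to [x] in the product. *)
  pose F : set_system (omega_power K) :=
    filter_from setT (fun n => [set y | agree n x y]).
  have FF : Filter F.
    apply: filter_from_filter; first by exists 0%N.
    move=> m n _ _; exists (maxn m n) => // y xy; split.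
      exact: agree_leq (leq_maxl _ _) xy.
    exact: agree_leq (leq_maxr _ _) xy.
  suff : F --> x by move=> /(_ U)/[apply] -[n _ nU]; exists n.
  apply/cvg_sup => i V [W [[Q oQ <-] Qx QV]].
  apply: (filterS QV); exists i.+1 => // y xy /=.
  by rewrite /= -(xy i).
move=> [n nU]; apply: (@filterS _ (nbhs x) _ (agree n x)) => // {nU}.
elim: n => [|n IH]; first by apply: (@filterS _ (nbhs x) _ setT) => //; exact: filterT.
have : nbhs x [set y : omega_power K | y n = x n].
  apply: (@proj_continuous nat (fun=> discrete_topology K) n x [set x n]).
  exact: discrete_set1.
move=> nx; have Fx : Filter (nbhs x) := nbhs_filter x.
apply: (@filterS _ (nbhs x) Fx _ _ _ (@filterI _ (nbhs x) Fx _ _ IH nx)).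
by move=> y [xy yn]; apply: agreeS.
Qed.

Lemma continuous_omega_powerP (K : choiceType) (T : topologicalType)
    (f : omega_power K -> T) :
  continuous f <-> forall x U, nbhs (f x) U ->
    exists n, forall y, agree n x y -> U (f y).
Proof.
split=> fc x U; first by move=> /(fc x)/nbhs_omega_power.
by move=> /fc ?; exact/nbhs_omega_power.
Qed.

Section sigma_algebra_closure.
Variables (T : Type) (G : set (set T)) (Gs : sigma_algebra setT G).

Lemma sigma_algebra_setC A : G A -> G (~` A).
Proof. by case: Gs => _ GC _ /GC; rewrite setTD. Qed.

Lemma sigma_algebra_bigcup_countType (I : countType) (F : I -> set T) :
  (forall i, G (F i)) -> G (\bigcup_i F i).
Proof.
move=> GF; case: Gs => G0 _ GU.
rewrite (_ : \bigcup_i F i = \bigcup_n oapp F set0 (unpickle n)).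
  by apply: GU => n; case: unpickle.
apply/seteqP; split=> [x [i _ Fi]|x [n _]].
  by exists (pickle i) => //; rewrite pickleK.
by case: unpickle => // i Fi; exists i.
Qed.

Lemma sigma_algebra_bigcap_countType (I : countType) (F : I -> set T) :
  (forall i, G (F i)) -> G (\bigcap_i F i).
Proof.
move=> GF; rewrite -[\bigcap_i _]setCK setC_bigcap.
apply: sigma_algebra_setC; apply: sigma_algebra_bigcup_countType => i.
exact: sigma_algebra_setC.
Qed.

Lemma sigma_algebra_setI A B : G A -> G B -> G (A `&` B).
Proof.
move=> GA GB; rewrite (_ : _ `&` _ = \bigcap_b if b then A else B).
  by apply: sigma_algebra_bigcap_countType => -[].
by apply/seteqP; split=> [x [] ? ? [] _|x AB]//; split; [exact: (AB true)|exact: (AB false)].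
Qed.

End sigma_algebra_closure.

Lemma borel_sigma_algebra (X : topologicalType) :
  sigma_algebra setT (@borel_set X).
Proof. exact: smallest_sigma_algebra. Qed.

Lemma borel_open (X : topologicalType) (A : set X) : open A -> borel_set A.
Proof. exact: sub_sigma_algebra. Qed.

Lemma borel_closed (X : topologicalType) (A : set X) : closed A -> borel_set A.
Proof.
move=> cA; rewrite -[A]setCK; apply: (sigma_algebra_setC (@borel_sigma_algebra X)).
exact: (borel_open (closed_openC cA)).
Qed.

Definition cylinder (s : seq nat) : set (nat -> nat) :=
  [set y | forall i, (i < size s)%N -> y i = nth 0%N s i].

Lemma cylinderS s : cylinder s = \bigcup_a cylinder (rcons s a).
Proof.
apply/seteqP; split=> [x xs|x [a _ xa] i si]; last first.
  by rewrite xa ?size_rcons ?ltnS 1?ltnW// nth_rcons si.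
exists (x (size s)) => // i; rewrite size_rcons ltnS nth_rcons leq_eqVlt.
by move=> /orP[/eqP->|si]; [rewrite ltnn eqxx|rewrite si xs].
Qed.

(** There are countably many cylinders over [nat]: an open set is a countable union of them, and
    each is a finite intersection of sets [y i = n]. *)
Lemma borel_omega_power_nat (G : set (set (omega_power nat))) :
  sigma_algebra setT G -> (forall i n, G [set y | y i = n]) ->
  @borel_set (omega_power nat) `<=` G.
Proof.
move=> Gs Gc; apply: smallest_sub => // U.
have [G0 GC GU] := Gs.
have GT : G setT by rewrite -[setT]setD0; exact: GC.
have Gcyl s : G (cylinder s).
  elim/last_ind: s => [|s a IH].
    by rewrite (_ : cylinder [::] = setT)//; apply/seteqP; split.
  rewrite (_ : cylinder _ = cylinder s `&` [set y | y (size s) = a]).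
    exact: sigma_algebra_setI.
  rewrite (cylinderS s); apply/seteqP; split=> [y ya|y [[c _ yc] ysa]].
    by split; [exists a|rewrite /= ya ?size_rcons// nth_rcons ltnn eqxx].
  by move: (yc); rewrite -ysa yc ?size_rcons// nth_rcons ltnn eqxx.
rewrite openE => oU.
rewrite (_ : U = \bigcup_s if `[< cylinder s `<=` U >] then cylinder s else set0).
  apply: sigma_algebra_bigcup_countType => // s.
  by case: ifP => _; [exact: Gcyl|exact: G0].
apply/seteqP; split=> [x Ux|x [s _]]; last by case: asboolP => // sU; exact: sU.
have /nbhs_omega_power[n nU] := oU _ Ux.
exists (mkseq x n) => //; rewrite asboolT => [i|y ys].
  by rewrite size_mkseq => ni; rewrite nth_mkseq.
apply: nU => i ni; move: (ys i); rewrite size_mkseq => /(_ ni).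
by rewrite nth_mkseq// => ->.
Qed.

Local Open Scope ring_scope.

(** * A condensation of the Baire space onto the line *)

Section interval_coding.
Variable R : realType.
Implicit Types (x y : nat -> nat) (r : R) (I : R * R).

Definition int_of_code (n : nat) : int :=
  if odd n then Negz n./2 else Posz n./2.

Lemma int_of_code_surj (z : int) : exists n, int_of_code n = z.
Proof.
case: z => m; [exists m.*2|exists m.*2.+1].
  by rewrite /int_of_code odd_double doubleK.
by rewrite /int_of_code /= odd_double /= uphalf_double.
Qed.

Lemma int_of_code_inj : injective int_of_code.
Proof.
move=> m n; rewrite /int_of_code; case: ifP => om; case: ifP => on // [] e.
  by rewrite -[m]odd_double_half -[n]odd_double_half e om on.
by rewrite -[m]odd_double_half -[n]odd_double_half e om on.
Qed.

(** The pieces [[cut m, cut m.+1[] tile [[0, 1[], and each ends strictly before 1. *)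
Definition cut (m : nat) : R := 1 - m.+1%:R^-1.

Lemma cut0 : cut 0 = 0. Proof. by rewrite /cut invr1 subrr. Qed.

Lemma cut_lt1 m : cut m < 1.
Proof. by rewrite /cut ltrBlDr ltrDl invr_gt0. Qed.

Lemma cut_le m n : (m <= n)%N -> cut m <= cut n.
Proof. by move=> mn; rewrite /cut lerD2l lerN2 lef_pV2 ?posrE// ler_nat. Qed.

Lemma cut_ltS m : cut m < cut m.+1.
Proof. by rewrite /cut ltrD2l ltrN2 ltf_pV2 ?posrE// ltr_nat. Qed.

Lemma cut_ge0 m : 0 <= cut m. Proof. by rewrite -cut0 cut_le. Qed.

(** The first piece has length one half, and all later ones lie in [[1/2, 1[]. *)
Lemma cut_step m : cut m.+1 - cut m <= 2^-1.
Proof.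
case: m => [|m].
  by rewrite cut0 /cut; lra.
have := cut_lt1 m.+2; have : cut 1 <= cut m.+1 by exact: cut_le.
by rewrite {1}/cut; lra.
Qed.

Lemma cut_split t : 0 <= t < 1 -> exists m, cut m <= t < cut m.+1.
Proof.
move=> /andP[t0 t1].
have ex : exists m, t < cut m.+1.
  exists (Num.truncn (1 - t)^-1); rewrite /cut.
  have h : (1 - t)^-1 < (Num.truncn (1 - t)^-1).+1%:R by exact: truncnS_gt.
  have : ((Num.truncn (1 - t)^-1).+2)%:R^-1 < 1 - t.
    rewrite -[ltRHS]invrK ltf_pV2 ?posrE ?invr_gt0 ?subr_gt0//.
    by apply: (lt_trans h); rewrite ltr_nat.
  by rewrite ltrBrDr -ltrBrDl.
case: (ex_minnP ex) => m tm mmin; exists m; rewrite tm andbT.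
case: m tm mmin => [|m] tm mmin; first by rewrite cut0.
by rewrite leNgt; apply/negP => /mmin; rewrite ltnn.
Qed.

Lemma cut_disj m n t : cut m <= t < cut m.+1 -> cut n <= t < cut n.+1 -> m = n.
Proof.
wlog : m n / (m <= n)%N => [wl mt nt|].
  by have [|/ltnW] := leqP m n => h; [exact: wl|apply/esym/wl].
rewrite leq_eqVlt => /orP[/eqP//|mn] /andP[_ tm] /andP[nt _].
by have := lt_le_trans tm (le_trans (cut_le mn) nt); rewrite ltxx.
Qed.

(* A pair [I] stands for the half-open interval [[I.1, I.1 + I.2[]. *)
Definition inside I : set R := [set r | I.1 <= r < I.1 + I.2].

Definition cut_step_itv I m : R * R :=
  (I.1 + I.2 * cut m, I.2 * (cut m.+1 - cut m)).

(** The intervals of one level tile the line. Entry 0 is spent on the integer part, so level [n]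
    depends on [n.+1] entries. *)
Fixpoint itv_of x n : R * R := if n is k.+1 then cut_step_itv (itv_of x k) (x n)
  else ((int_of_code (x 0%N))%:~R, 1).

Lemma itv_of_agree x y n : agree n.+1 x y -> itv_of x n = itv_of y n.
Proof.
elim: n => [|n IH] xy /=; first by rewrite xy.
by rewrite xy// IH//; exact: agree_leq xy.
Qed.

Lemma itv_of_gt0 x n : 0 < (itv_of x n).2.
Proof. by elim: n => //= n IH; rewrite mulr_gt0// subr_gt0 cut_ltS. Qed.

Lemma itv_of_le x n : (itv_of x n).2 <= 2^-1 ^+ n.
Proof.
elim: n => [|n IH] /=; first by rewrite expr0.
rewrite exprSr ler_pM ?cut_step// ?subr_ge0; first exact/ltW/itv_of_gt0.
exact/ltW/cut_ltS.
Qed.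

Lemma inside_cut_step I m r : 0 < I.2 ->
  inside (cut_step_itv I m) r <-> cut m <= (r - I.1) / I.2 < cut m.+1.
Proof.
move=> I0; rewrite /inside /= ler_pdivlMr// ltr_pdivrMr//.
rewrite [cut m * _]mulrC [cut m.+1 * _]mulrC lerBrDl ltrBlDl.
by rewrite -addrA -mulrDr subrKC.
Qed.

Lemma inside_frac I r : 0 < I.2 -> inside I r <-> 0 <= (r - I.1) / I.2 < 1.
Proof.
by move=> I0; rewrite /inside /= ler_pdivlMr// ltr_pdivrMr// mul0r mul1r subr_ge0 ltrBlDl.
Qed.

Lemma inside_stepS I m : 0 < I.2 -> inside (cut_step_itv I m) `<=` inside I.
Proof.
move=> I0 r /(inside_cut_step _ _ I0)/andP[mr rm]; apply/(inside_frac _ I0).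
by rewrite (le_trans (cut_ge0 m) mr) (lt_trans rm (cut_lt1 _)).
Qed.

(** The right ends decrease strictly, so the supremum of the left ends stays below all of them
    although the intervals are half-open. *)
Lemma itv_of_nonempty x : exists r, forall n, inside (itv_of x n) r.
Proof.
pose lo n := (itv_of x n).1; pose hi n := lo n + (itv_of x n).2.
have loS n : lo n <= lo n.+1.
  by rewrite /lo /= lerDl mulr_ge0// ?cut_ge0//; exact/ltW/itv_of_gt0.
have hiS n : hi n.+1 < hi n.
  rewrite /hi /lo /= -addrA -mulrDr subrKC ltrD2l -[ltRHS]mulr1.
  by rewrite ltr_pM2l ?cut_lt1// itv_of_gt0.
have lohi n : lo n < hi n by rewrite /hi ltrDl itv_of_gt0.
have lohi2 m n : lo m <= hi n.
  have [mn|/ltnW nm] := leqP m n.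
    apply: le_trans (ltW (lohi n)).
    by apply: (@homo_leq _ lo (fun a b => a <= b)) => // ? ? ?; exact: le_trans.
  apply: le_trans (ltW (lohi m)) _.
  apply: (@homo_leq _ hi (fun a b => b <= a)) => //.
    by move=> a b c /[swap]; exact: le_trans.
  by move=> k; exact/ltW.
have sup_lo : has_sup (range lo).
  by split; [exists (lo 0%N); exists 0%N|exists (hi 0%N) => _ [m _ <-]].
exists (sup (range lo)) => n; apply/andP; split.
  by apply: ub_le_sup; [case: sup_lo|exists n].
apply: le_lt_trans (hiS n); apply: ge_sup; first by case: sup_lo.
by move=> _ [m _ <-].
Qed.

Definition real_of_seq x : R := projT1 (cid (itv_of_nonempty x)).

Lemma real_of_seq_inside x n : inside (itv_of x n) (real_of_seq x).
Proof. exact: (projT2 (cid (itv_of_nonempty x))). Qed.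

Lemma inside_agree x y r n : inside (itv_of x n) r -> inside (itv_of y n) r ->
  agree n.+1 x y.
Proof.
elim: n => [|n IH] xr yr.
  apply: agreeS => //; apply: int_of_code_inj.
  have fl (m : int) : m%:~R <= r < m%:~R + 1 -> Num.floor r = m.
    by move=> mr; apply: floor_def; rewrite intrD.
  by rewrite -(fl _ xr) -(fl _ yr).
have xy : agree n.+1 x y 
  by apply: IH; [move: xr|move: yr]; exact/inside_stepS/itv_of_gt0.
apply: agreeS => //; move: xr yr => /=.
rewrite (itv_of_agree xy) => /(inside_cut_step _ _ (itv_of_gt0 _ _)) h.
by move=> /(inside_cut_step _ _ (itv_of_gt0 _ _)); exact: cut_disj.
Qed.

Lemma seq_of_real r : exists x, forall n, inside (itv_of x n) r.
Proof.
have [d0 d0P] : exists d, inside ((int_of_code d)%:~R, 1) r.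
  have [d dE] := int_of_code_surj (Num.floor r); exists d.
  by rewrite dE; have := floor_itv r; rewrite intrD.
have /choice[D DP] I : exists m, 0 < I.2 -> inside I r -> inside (cut_step_itv I m) r.
  have [I0|] := pselect (0 < I.2); last by exists 0%N.
  have [rI|] := pselect (inside I r); last by exists 0%N.
  have [m mP] := cut_split ((inside_frac _ I0).1 rI).
  by exists m => _ _; exact/inside_cut_step.
pose S := fix S n := if n is k.+1 then cut_step_itv (S k) (D (S k))
  else ((int_of_code d0)%:~R : R, 1 : R).
pose x n := if n is k.+1 then D (S k) else d0.
have xS n : itv_of x n = S n by elim: n => //= n ->.
exists x; elim=> [//|n IH] /=; rewrite xS; apply: DP; last by rewrite -xS.
by rewrite -xS itv_of_gt0.
Qed.

Lemma inside_dist I r s : inside I r -> inside I s -> `|r - s| < I.2.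
Proof. by rewrite /inside /= => /andP[? ?] /andP[? ?]; rewrite ltr_norml; lra. Qed.

Lemma half_expn_lt (e : R) : 0 < e -> exists n, 2^-1 ^+ n < e.
Proof.
move=> e0; exists (Num.truncn e^-1).+1.
rewrite exprVn -[ltRHS]invrK ltf_pV2 ?posrE ?invr_gt0 ?exprn_gt0//.
apply: (lt_trans (truncnS_gt _)); rewrite -natrX ltr_nat; exact: ltn_expl.
Qed.

Lemma real_of_seq_eq x r : (forall n, inside (itv_of x n) r) -> real_of_seq x = r.
Proof.
move=> xr; apply/eqP; rewrite -subr_eq0 -normr_le0 leNgt; apply/negP.
move=> /half_expn_lt[n]; apply/negP; rewrite -leNgt.
apply: le_trans (itv_of_le x n); apply/ltW/inside_dist => //.
exact: real_of_seq_inside.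
Qed.

Lemma real_of_seq_bij : bijective real_of_seq.
Proof.
rewrite -setTT_bijective; split => // [x y _ _ xy|r _].
  apply/funext => n.
  suff : agree n.+1 x y by apply.
  have := real_of_seq_inside y n; rewrite -xy.
  exact: inside_agree (real_of_seq_inside x n).
by have [x xr] := seq_of_real r; exists x => //; exact: real_of_seq_eq.
Qed.

Lemma real_of_seq_continuous : continuous (real_of_seq : omega_power nat -> R).
Proof.
apply/continuous_omega_powerP => x U /nbhs_ballP[e /= e0 eU].
have [n ne] := half_expn_lt e0; exists n.+1 => y xy; apply: eU.
rewrite /ball /=; apply: lt_trans ne; apply: lt_le_trans (itv_of_le x n).
apply: inside_dist; first exact: real_of_seq_inside.
by rewrite (itv_of_agree xy); exact: real_of_seq_inside.
Qed.

Lemma borel_inside I : borel_set (inside I).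
Proof.
rewrite (_ : inside I = ~` [set r | r < I.1] `&` [set r | r < I.1 + I.2]).
  apply: (sigma_algebra_setI (@borel_sigma_algebra R)); last exact: (borel_open (@open_lt R _)).
  by apply: (sigma_algebra_setC (@borel_sigma_algebra R)); exact: (borel_open (@open_lt R _)).
apply/seteqP; split=> r /=; rewrite /inside /=.
  by move=> /andP[Ir ?]; split=> //; apply/negP; rewrite -leNgt.
by move=> [/negP]; rewrite -leNgt => -> ->.
Qed.

(** Images under a bijection commute with complements, so it suffices to treat the sets [y i = n],
    whose images are countable unions of intervals of level [i]. *)
Lemma borel_real_of_seq_image (B : set (omega_power nat)) :
  borel_set B -> borel_set (real_of_seq @` B).
Proof.
have uinj : injective real_of_seq by exact: bij_inj real_of_seq_bij.
move: B; apply: borel_omega_power_nat.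
  split=> [|A BA|A BA] /=.
  - by rewrite image_set0; exact: sigma_algebra0.
  - rewrite setTD (_ : _ @` _ = ~` (real_of_seq @` A)).
      exact: (sigma_algebra_setC (@borel_sigma_algebra R)).
    apply/seteqP; split=> [_ [x nAx <-] [y Ay /uinj yx]|r nAr].
      by apply: nAx; rewrite -yx.
    have [v uv vu] := real_of_seq_bij; exists (v r); last exact: vu.
    by move=> Av; apply: nAr; exists (v r).
  - by rewrite image_bigcup; exact: sigma_algebra_bigcup.
move=> i n /=.
rewrite (_ : _ @` _ = \bigcup_(s : seq nat)
    if nth 0%N s i == n then inside (itv_of (nth 0%N s) i) else set0).
  apply: (sigma_algebra_bigcup_countType (@borel_sigma_algebra R)) => s.
  by case: ifP => _; [exact: borel_inside|exact: sigma_algebra0].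
apply/seteqP; split=> [_ [x <- <-]|r [s _]].
  have xs : agree i.+1 x (nth 0%N (mkseq x i.+1)) by move=> j ji; rewrite nth_mkseq.
  exists (mkseq x i.+1) => //; rewrite -xs// eqxx -(itv_of_agree xs).
  exact: real_of_seq_inside.
case: eqP => // sn rs; have [x xr] := seq_of_real r.
exists x; last exact: real_of_seq_eq.
by rewrite /= -sn; exact: (inside_agree (xr i) rs).
Qed.

End interval_coding.

(** * From Borel partitions to condensations *)

Lemma borel_preimage (X Y : topologicalType) (f : X -> Y) (B : set Y) :
  continuous f -> borel_set B -> borel_set (f @^-1` B).
Proof.
move=> fc; move: B; apply: smallest_sub; last first.
  by move=> U oU; apply: borel_open; apply: open_comp => // x _; exact: fc.
have sX := @borel_sigma_algebra X.
split=> [|A BA|A BA].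
- by rewrite /= preimage_set0; case: sX.
- by rewrite setTD; exact: (sigma_algebra_setC sX).
- by rewrite /= preimage_bigcup; apply: (sigma_algebra_bigcup_countType sX).
Qed.

Lemma borel_uniquely_witnessed (B : set (omega_power nat)) :
  borel_set B -> uniquely_witnessed B.
Proof.
move=> /(borel_omega_power_nat sigma_algebra_uniquely_witnessed) [] // i n.
have cl (Q : nat -> Prop) : seq_closed [set y : nat -> nat | Q (y i)].
  by move=> x /(_ i.+1)[y Qy xy]; rewrite /= xy.
split; apply: uniquely_witnessed_closed; first exact: (cl (eq^~ n)).
exact: (cl (fun m => m <> n)).
Qed.

Lemma sp_borel_condensation (R : realType) (K : choiceType) :
  ~ countable [set: K] -> sp_borel R K ->
  exists2 f : omega_power K -> R, continuous f & bijective f.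
Proof.
move=> Kunc [P [[Pcov Pdisj P0] Pborel _ PK]].
have Kinf : infinite_set [set: K] by move=> /finite_set_countable.
have [b [bP binj bsurj]] : exists b : K -> set R, set_bij setT P b.
  by move: PK; rewrite card_eq_sym => /card_set_bijP.
pose u := @real_of_seq R; have ubij : bijective u := @real_of_seq_bij R.
have [v uv vu] := ubij.
have [|k||h hbij hagr] := @partition_seq_bij K (fun k => u @^-1` b k).
- exact: Kinf.
- apply: borel_uniquely_witnessed; apply: borel_preimage; last exact: Pborel (bP k I).
  exact: real_of_seq_continuous.
- split.
  + apply/seteqP; split => // x _.
    have : cover P id (u x) by rewrite Pcov.
    by move=> [A /bsurj[k _ <-] Ax]; exists k.
  + move=> k l _ _ [x [kx lx]]; apply: binj; [exact: mem_set|exact: mem_set|].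
    by apply: Pdisj; [exact: bP|exact: bP|exists (u x)].
  + by move=> k _; have [r br] := P0 _ (bP k I); exists (v r); rewrite /= vu.
exists (u \o h : omega_power K -> R); last exact: bij_comp.
apply/continuous_omega_powerP => x U.
have /continuous_omega_powerP uc := @real_of_seq_continuous R.
by move=> /uc[n nU]; exists n => y xy; apply: nU; exact: hagr.
Qed.

(** * A condensation of the line onto a compact space *)

(* The line whose two ends are bent back to the origin, as in the
   parametrisation [t |-> (t, t^3) / (1 + t^4)] of the lemniscate. *)
Definition looped_line (R : realType) : Type := R.

Section looped_line.
Variable R : realType.
HB.instance Definition _ := Choice.on (looped_line R).
Implicit Types s t : R.

Let den t : R := 1 + t ^+ 4.
Let X t : R := t / den t.
Let Y t : R := t ^+ 3 / den t.

Let den_gt0 t : 0 < den t.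
Proof. by rewrite /den; have := sqr_ge0 (t ^+ 2); rewrite -exprM; lra. Qed.

(** The l1 distance of the plane, pulled back along the parametrisation. *)
Definition looped_dist (s t : looped_line R) : R := `|X s - X t| + `|Y s - Y t|.

Let looped_distxx t : looped_dist t t = 0.
Proof. by rewrite /looped_dist !subrr normr0 addr0. Qed.

Let looped_dist_sym s t : looped_dist s t = looped_dist t s.
Proof. by rewrite /looped_dist distrC [X in _ + X]distrC. Qed.

Let looped_dist_triangle t s r : looped_dist s r <= looped_dist s t + looped_dist t r.
Proof.
rewrite /looped_dist.
have := ler_distD (X t) (X s) (X r); have := ler_distD (Y t) (Y s) (Y r); lra.
Qed.

(** Away from the origin, [Y t / X t] is [t ^+ 2], which determines [den t] and then [t]. *)
Let looped_dist_eq0 s t : looped_dist s t = 0 -> s = t.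
Proof.
rewrite /looped_dist => st.
have := normr_ge0 (X s - X t); have := normr_ge0 (Y s - Y t) => Y0 X0.
have /eqP : `|X s - X t| = 0 by lra.
have /eqP : `|Y s - Y t| = 0 by lra.
rewrite !normr_eq0 !subr_eq0 /X /Y => /eqP eY /eqP eX.
have [ds dt] := (den_gt0 s, den_gt0 t).
have s0 : s = 0 -> t = 0.
  move=> s0; move: eX; rewrite s0 mul0r => /esym/eqP.
  by rewrite mulf_eq0 invr_eq0 (gt_eqF dt) orbF => /eqP.
have [/s0->//|sn0] := eqVneq s 0.
have es2 : s ^+ 2 = t ^+ 2.
  have : s ^+ 2 * (s / den s) = t ^+ 2 * (s / den s) by rewrite {2}eX !mulrA -!exprSr eY.
  by apply: mulIf; rewrite mulf_neq0// invr_eq0 (gt_eqF ds).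
have dE : den s = den t by rewrite /den (_ : 4 = 2 * 2)%N// !exprM es2.
by move: eX; rewrite dE; apply: mulIf; rewrite invr_eq0 (gt_eqF dt).
Qed.

HB.instance Definition _ := isMetric.Build R (looped_line R)
  looped_distxx looped_dist_eq0 looped_dist_sym looped_dist_triangle.

Let X_continuous : continuous (X : R -> R).
Proof.
move=> t; apply: cvgM; first exact: cvg_id.
apply: cvgV; first by rewrite (gt_eqF (den_gt0 t)).
by apply: cvgD; [exact: cvg_cst|exact: exprn_continuous].
Qed.

Let Y_continuous : continuous (Y : R -> R).
Proof.
move=> t; apply: cvgM; first exact: exprn_continuous.
apply: cvgV; first by rewrite (gt_eqF (den_gt0 t)).
by apply: cvgD; [exact: cvg_cst|exact: exprn_continuous].
Qed.

Lemma looped_line_continuous : continuous (id : R -> looped_line R).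
Proof.
move=> t U /nbhs_ballP[e /= e0 eU].
have e20 : 0 < e / 2 by rewrite divr_gt0.
have /nbhs_ballP[d1 /= d10 Xd] := X_continuous (nbhsx_ballx (X t) _ e20).
have /nbhs_ballP[d2 /= d20 Yd] := Y_continuous (nbhsx_ballx (Y t) _ e20).
apply/nbhs_ballP; exists (Num.min d1 d2); first by rewrite /= lt_min d10.
move=> s /= st; apply: eU; rewrite ballEmdist /=.
have m1 : Num.min d1 d2 <= d1 by rewrite ge_min lexx.
have m2 : Num.min d1 d2 <= d2 by rewrite ge_min lexx orbT.
have := Xd s (le_ball m1 st); have := Yd s (le_ball m2 st).
by rewrite /ball /= /mdist /= /looped_dist; lra.
Qed.

(** Both ends of the line approach the origin. The bound amounts to [t^2 + t^4 <= 2 (1 + t^4)], a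
    consequence of [(t^2 - 1)^2 >= 0]. *)
Let looped_dist0_le t : looped_dist 0 t * `|t| <= 2.
Proof.
have dt := den_gt0 t.
have den4 : `|t| ^+ 4 = t ^+ 4 by rewrite -normrX ger0_norm// exprn_even_ge0.
have XE : `|X t| * `|t| = `|t| ^+ 2 / den t.
  by rewrite /X normrM normfV (gtr0_norm dt) mulrAC -expr2.
have YE : `|Y t| * `|t| = `|t| ^+ 4 / den t.
  by rewrite /Y normrM normfV (gtr0_norm dt) normrX mulrAC -exprSr.
rewrite /looped_dist /X /Y expr0n !mul0r !sub0r !normrN -/(X t) -/(Y t).
rewrite mulrDl XE YE -mulrDl ler_pdivrMr// /den -den4.
have := sqr_ge0 (`|t| ^+ 2 - 1); rewrite sqrrB1 -exprM.
by have := exprn_ge0 4 (normr_ge0 t); lra.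
Qed.

(** A filter that does not cluster at the origin contains a segment. A cluster point there for the
    usual topology is also one for the coarser looped topology. *)
Lemma looped_line_compact : compact [set: looped_line R].
Proof.
move=> F PF _.
have [cl0|] := pselect (cluster F (0 : looped_line R)).
  by exists (0 : looped_line R).
move=> /existsNP[A /existsNP[B /not_implyP[FA /not_implyP[nB AB]]]].
have /nbhs_ballP[e /= e0 eB] := nB.
(* Beyond [n] the bound [2 / |t|] on the distance to the origin is less than [e]. *)
pose n := 2 / e + 1.
have Fn : F [set` `[- n, n]].
  apply: filterS FA => t At; rewrite /= in_itv /= -ler_norml leNgt; apply/negP => nt.
  apply: AB; exists t; split => //; apply: eB; rewrite ballEmdist /=.
  have t0 : 0 < `|t : R| by apply: lt_trans nt; rewrite /n addr_gt0// divr_gt0.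
  have := looped_dist0_le t; rewrite -ler_pdivlMr// => /le_lt_trans; apply.
  rewrite ltr_pdivrMr// -ltr_pdivrMl// mulrC; apply: lt_trans nt.
  by rewrite /n ltrDl.
have [p [_ pF]] := @segment_compact R (- n) n F PF Fn.
by exists p; split=> // A' B' FA' /looped_line_continuous; exact: pF.
Qed.

End looped_line.

(** * The Lusin-Souslin theorem *)

Definition incompatible (s t : seq nat) : Prop :=
  exists i, [/\ (i < size s)%N, (i < size t)%N & nth 0%N s i <> nth 0%N t i].

Lemma incompatible_sym s t : incompatible s t -> incompatible t s.
Proof. by move=> [i [si ti /nesym st]]; exists i. Qed.

Lemma cylinder_incompatible s t x : incompatible s t -> cylinder s x -> ~ cylinder t x.
Proof. by move=> [i [si ti st]] xs xt; apply: st; rewrite -xs// -xt. Qed.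

Lemma cylinder_agree s x y : cylinder s x -> cylinder s y -> agree (size s) x y.
Proof. by move=> xs ys i si; rewrite xs// ys. Qed.

Lemma cylinder_branch (s : nat -> seq nat) :
  (forall m n, ~ incompatible (s m) (s n)) -> (forall n, n <= size (s n))%N ->
  exists x, forall n, cylinder (s n) x.
Proof.
(* [s i.+1] is long enough to have an entry at position [i], and by compatibility the others agree
   with it. *)
move=> sc ss; exists (fun i => nth 0%N (s i.+1) i) => n i ni.
by apply: contrapT => ne; apply: (sc i.+1 n); exists i; split=> //; exact: ss.
Qed.

Lemma rcons_chain (s : nat -> seq nat) :
  (forall n, exists a, s n.+1 = rcons (s n) a) ->
  (forall m n, ~ incompatible (s m) (s n)) /\ (forall n, n <= size (s n))%N.
Proof.
move=> sS; split; last first.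
  by elim=> // n IH; have [a ->] := sS n; rewrite size_rcons.
have ext m d i : (i < size (s m))%N ->
    (i < size (s (m + d)%N))%N /\ nth 0%N (s (m + d)%N) i = nth 0%N (s m) i.
  move=> im; elim: d => [|d [IHs IHn]]; first by rewrite addn0.
  have [a] := sS (m + d)%N; rewrite addnS => ->.
  by rewrite size_rcons nth_rcons IHs ltnW.
move=> m n [i [im inn]]; apply.
have [mn|/ltnW nm] := leqP m n.
  by have [_] := ext m (n - m)%N i im; rewrite subnKC.
by have [_] := ext n (m - n)%N i inn; rewrite subnKC.
Qed.

Section borel_separation.
Variable M : topologicalType.
Implicit Types A B : set M.

Definition borel_separated A B : Prop :=
  exists2 D, borel_set D & A `<=` D /\ B `<=` ~` D.

(** Used contrapositively: if two countable unions cannot be separated, neither can some pair of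
    their pieces. *)
Lemma borel_separated_bigcup (A B : nat -> set M) :
  (forall m n, borel_separated (A m) (B n)) ->
  borel_separated (\bigcup_m A m) (\bigcup_n B n).
Proof.
move=> /(_ _ _)/cid2 AB; pose D m n := s2val (AB m n).
have DP m n : [/\ borel_set (D m n), A m `<=` D m n & B n `<=` ~` D m n].
  by have [? ?] := s2valP' (AB m n); split=> //; exact: s2valP (AB m n).
have sM := @borel_sigma_algebra M.
exists (\bigcup_m \bigcap_n D m n).
  apply: (sigma_algebra_bigcup_countType sM) => m.
  by apply: (sigma_algebra_bigcap_countType sM) => n; case: (DP m n).
split=> [x [m _ Am]|x [n _ Bn] [m _ Dx]].
  by exists m => // n _; case: (DP m n) => _ + _; apply.
by case: (DP m n) => _ _ /(_ x Bn); apply; exact: Dx.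
Qed.

End borel_separation.

Section lusin_souslin.
Variables (M : topologicalType) (F : set (nat -> nat)) (f : (nat -> nat) -> M).
Hypotheses (hM : hausdorff_space M) (Fcl : seq_closed F).
Hypothesis fc : forall x U, F x -> nbhs (f x) U ->
  exists n, forall y, F y -> agree n x y -> U (f y).
Hypothesis finj : {in F &, injective f}.

Let C s : set M := f @` (F `&` cylinder s).

Let C_rcons s : C s = \bigcup_a C (rcons s a).
Proof. by rewrite /C -image_bigcup -setI_bigcupr -cylinderS. Qed.

(** Closedness puts the branch in [F], and continuity shrinks the images [C (s n)] to [f x]. *)
Let C_branch (s : nat -> seq nat) :
    (forall n, C (s n) !=set0) -> (forall n, n <= size (s n))%N ->
    forall x, (forall n, cylinder (s n) x) ->
  F x /\ forall U, nbhs (f x) U -> exists n, C (s n) `<=` U.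
Proof.
move=> C0 ss x xs.
have Fx : F x.
  apply: Fcl => n; have [_ [y [Fy ys] _]] := C0 n; exists y => //.
  exact: agree_leq (ss n) (cylinder_agree (xs n) ys).
split=> // U /(fc Fx)[n nU]; exists n => _ [y [Fy ys] <-]; apply: nU => //.
exact: agree_leq (ss n) (cylinder_agree (xs n) ys).
Qed.

(** Lusin separation: a non-separated pair of nodes has a non-separated pair of children, and so on
    along two branches [x] and [y], distinct by incompatibility. Disjoint open neighbourhoods of
    [f x] and [f y] separate the images at a late enough level, a contradiction. *)
Let C_separated s t : incompatible s t -> borel_separated (C s) (C t).
Proof.
move=> st; apply: contrapT => nsep.
have /choice[next nextP] (p : seq nat * seq nat) : exists ab : nat * nat,
    ~ borel_separated (C p.1) (C p.2) ->
    ~ borel_separated (C (rcons p.1 ab.1)) (C (rcons p.2 ab.2)).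
  have [sep|nsepp] := pselect (borel_separated (C p.1) (C p.2)).
    by exists (0%N, 0%N).
  apply: contrapT => /forallNP h; apply: nsepp.
  rewrite (C_rcons p.1) (C_rcons p.2); apply: borel_separated_bigcup => a b.
  by apply: contrapT => nab; apply: (h (a, b)).
pose p := fix p n := if n is k.+1 then
  (rcons (p k).1 (next (p k)).1, rcons (p k).2 (next (p k)).2) else (s, t).
have psep n : ~ borel_separated (C (p n).1) (C (p n).2).
  by elim: n => [//|n IH]; exact: (nextP (p n) IH).
have p1_0 n : C (p n).1 !=set0.
  apply/set0P/eqP => C0; apply: (psep n); exists set0; first exact: sigma_algebra0.
  by rewrite C0 setC0; split.
have p2_0 n : C (p n).2 !=set0.
  apply/set0P/eqP => C0; apply: (psep n); exists setT; last by rewrite C0; split.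
  exact: (borel_open openT).
have [c1 s1] : (forall m n, ~ incompatible (p m).1 (p n).1) /\
    (forall n, n <= size (p n).1)%N.
  by apply: (@rcons_chain (fun n => (p n).1)) => n; eexists.
have [c2 s2] : (forall m n, ~ incompatible (p m).2 (p n).2) /\
    (forall n, n <= size (p n).2)%N.
  by apply: (@rcons_chain (fun n => (p n).2)) => n; eexists.
have [x xp] := cylinder_branch c1 s1; have [y yp] := cylinder_branch c2 s2.
have [Fx xU] := C_branch p1_0 s1 xp; have [Fy yU] := C_branch p2_0 s2 yp.
have fxy : f x != f y.
  apply/eqP => /finj xy; apply: (cylinder_incompatible st (xp 0%N)).
  by rewrite xy ?mem_set//; exact: (yp 0%N).
move: (hM); rewrite open_hausdorff => /(_ _ _ fxy)[[U V]] /= [].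
move=> /set_mem Ux /set_mem Vy [oU oV UV].
have [m mU] := xU U (open_nbhs_nbhs (conj oU Ux)).
have [n nV] := yU V (open_nbhs_nbhs (conj oV Vy)).
have mono1 k : C (p (n + k)%N).2 `<=` C (p n).2.
  elim: k => [|k IH]; first by rewrite addn0.
  apply: subset_trans IH; rewrite addnS /= (C_rcons (p (n + k)%N).2) => z Cz.
  by exists (next (p (n + k)%N)).2.
have mono2 k : C (p (m + k)%N).1 `<=` C (p m).1.
  elim: k => [|k IH]; first by rewrite addn0.
  apply: subset_trans IH; rewrite addnS /= (C_rcons (p (m + k)%N).1) => z Cz.
  by exists (next (p (m + k)%N)).1.
apply: (psep (m + n)%N); exists U; first exact: borel_open.
split; first exact: subset_trans (mono2 n) mU.
rewrite addnC => z /mono1/nV Vz Uz.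
by have : (U `&` V) z by []; rewrite (eqP UV).
Qed.

(** The image is the intersection over [n] of the unions of [D s] for [s] of size [n], where the
    Borel set [D s] lies between [C s] and its closure. *)
Theorem lusin_souslin : borel_set (f @` F).
Proof.
have sM := @borel_sigma_algebra M.
have /choice[S SP] (st : seq nat * seq nat) : exists D : set M, borel_set D /\
    (incompatible st.1 st.2 -> C st.1 `<=` D /\ C st.2 `<=` ~` D).
  have [/C_separated[D bD DP]|nst] := pselect (incompatible st.1 st.2).
    by exists D.
  by exists setT; split=> //; exact: (borel_open openT).
(* Incompatible nodes get disjoint sets [D s], so that a point covered at every
   level determines a branch. *)
pose D s := closure (C s) `&` \bigcap_t if `[< incompatible s t >]
  then S (s, t) `&` ~` S (t, s) else setT.
have Dborel s : borel_set (D s).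
  apply: (sigma_algebra_setI sM).
    exact: (borel_closed (@closed_closure _ _)).
  apply: (sigma_algebra_bigcap_countType sM) => t; case: ifP => _.
    apply: (sigma_algebra_setI sM); first exact: (SP _).1.
    by apply: (sigma_algebra_setC sM); exact: (SP _).1.
  exact: (borel_open openT).
have CD s : C s `<=` D s.
  move=> z Cz; split; first exact: subset_closure.
  move=> t _; case: asboolP => // st; split.
    by have [_ /(_ st)[+ _]] := SP (s, t); apply.
  by have [_ /(_ (incompatible_sym st))[_]] := SP (t, s); apply.
have Ddisj s t z : D s z -> D t z -> ~ incompatible s t.
  move=> [_ /(_ t I) Ds] [_ /(_ s I) Dt] st.
  move: Ds Dt; rewrite !asboolT//; last exact: incompatible_sym.
  by move=> [_ nS] [S' _].
rewrite (_ : f @` F = \bigcap_n \bigcup_s if size s == n then D s else set0).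
  apply: (sigma_algebra_bigcap_countType sM) => n.
  apply: (sigma_algebra_bigcup_countType sM) => s.
  by case: ifP => _ //; exact: sigma_algebra0.
apply/seteqP; split=> [_ [x Fx <-] n _|z zD].
  exists (mkseq x n) => //; rewrite size_mkseq eqxx; apply: CD; exists x => //.
  by split=> // i; rewrite size_mkseq => ni; rewrite nth_mkseq.
have /choice[s sP] n : exists s, size s = n /\ D s z.
  by have [s _] := zD n I; case: eqP => // ss Ds; exists s.
have sc m n : ~ incompatible (s m) (s n) by apply: Ddisj; exact: (sP _).2.
have ss n : (n <= size (s n))%N by rewrite (sP n).1.
have [x xs] := cylinder_branch sc ss.
have C0 n : C (s n) !=set0.
  apply/set0P/eqP => Cs0; have [_ [+ _]] := sP n.
  by rewrite Cs0 closure0.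
have [Fx xU] := C_branch C0 ss xs; exists x => //.
(* A neighbourhood of [f x] contains some [C (s n)], whose closure contains [z]; so [f x] and [z]
   have no disjoint neighbourhoods. *)
apply: hM => A B /xU[n nA] nB.
have [_ [/(_ B nB)[w [Cw Bw]] _]] := sP n.
by exists w; split=> //; exact: nA.
Qed.

End lusin_souslin.

(** * Images of Polish subspaces *)

(** Recoding entries along an injection of [N] into [nat] carries [C] to a closed set of sequences
    of numbers, where [lusin_souslin] applies. *)
Lemma borel_image_closed (K : choiceType) (M : topologicalType)
    (f : omega_power K -> M) (C : set (omega_power K)) (N : set K) :
  hausdorff_space M -> continuous f -> injective f ->
  closed C -> countable N -> (forall x i, C x -> N (x i)) ->
  borel_set (f @` C).
Proof.
move=> hM fc finj Ccl /countable_injP[j jinj] CN.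
have [->|/set0P[x0 Cx0]] := eqVneq C set0.
  by rewrite image_set0; exact: sigma_algebra0.
pose F : set (nat -> nat) := [set j \o x | x in C].
have jC x y n : C x -> C y -> agree n (j \o x) (j \o y) -> agree n x y.
  move=> Cx Cy xy i ni; apply: jinj; [exact/mem_set/CN|exact/mem_set/CN|].
  exact: xy.
have /choice[g gP] z : exists x : nat -> K, F z -> C x /\ j \o x = z.
  have [[x Cx xz]|nFz] := pselect (F z); first by exists x.
  by exists x0.
have -> : f @` C = (f \o g) @` F.
  apply/seteqP; split=> [_ [x Cx <-]|_ [z Fz <-]]; last first.
    by have [Cg _] := gP z Fz; exists (g z).
  have Fx : F (j \o x) by exists x.
  exists (j \o x) => //=; congr f; have [Cg gx] := gP _ Fx.
  by apply/funext => i; apply: (jC _ _ i.+1) => // k _; rewrite gx.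
apply: lusin_souslin => //.
- move=> z zF.
  have /choice[y yP] n : exists y, C y /\ agree n z (j \o y).
    by have [_ [y Cy <-] zy] := zF n; exists y.
  (* Position [i] is decoded from [y i.+1], the first approximation known to match [z] there. *)
  pose x i := y i.+1 i.
  have jx : j \o x = z by apply/funext => i /=; rewrite (yP i.+1).2.
  exists x => //; rewrite closure_id in Ccl; rewrite Ccl => U.
  move=> /nbhs_omega_power[n nU]; have [Cy zy] := yP n.
  exists (y n); split=> //; apply: nU => i ni; apply: jinj.
  + exact: (mem_set (CN (y i.+1) i (yP i.+1).1)).
  + exact/mem_set/CN.
  + by rewrite -[LHS](yP i.+1).2// zy.
- move=> z U Fz /fc/nbhs_omega_power[n nU]; exists n => z' Fz' zz'; apply: nU.
  have [Cg gz] := gP z Fz; have [Cg' gz'] := gP z' Fz'.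
  by apply: jC => //; rewrite gz gz'.
- move=> z z' /set_mem Fz /set_mem Fz' /= /finj gzz'.
  by have [_ <-] := gP z Fz; have [_ <-] := gP z' Fz'; rewrite gzz'.
Qed.

Lemma nbhs_set_type (X : topologicalType) (A : set X) (a : A) (U : set A) :
  nbhs a U -> exists V : set X, [/\ open V, V (set_val a) &
    forall b : A, V (set_val b) -> U b].
Proof. by move=> [_ /= [] [V oV <- /= Va VU]]; exists V. Qed.

(** [Q n] is the union of the open sets whose trace on [A] is small for the complete metric; a point
    of the closure lying in every [Q n] is then a limit inside [A]. *)
Lemma completely_metrizable_Gdelta (R : realType) (X : topologicalType)
    (A : set X) : hausdorff_space X -> completely_metrizable R A ->
  exists2 Q : nat -> set X, forall n, open (Q n) &
    A = closure A `&` \bigcap_n Q n.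
Proof.
move=> hX [M Mcomplete [h [g [hg gh hc gc]]]].
pose small n (U : set X) := open U /\ forall a b : A,
  U (set_val a) -> U (set_val b) -> ball (h a) (2^-1 ^+ n : R) (h b).
exists (fun n => \bigcup_(U in small n) U).
  by move=> n; apply: bigcup_open => U [].
apply/seteqP; split=> [x Ax|z [clz zQ]].
  split; first exact: subset_closure.
  move=> n _; pose a : A := exist _ x (mem_set Ax).
  have e0 : 0 < (2^-1 ^+ n : R) / 2 by rewrite divr_gt0// exprn_gt0.
  have /nbhs_set_type[V [oV Va VU]] := hc a _ (nbhsx_ballx (h a) _ e0).
  exists V => //; split=> // b c /VU ab /VU ac.
  exact: ball_splitr ab ac.
(* The trace on [A] of the neighbourhoods of [z] is a Cauchy filter. *)
pose F : set_system M := fun S =>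
  exists2 V : set X, nbhs z V & forall a : A, V (set_val a) -> S (h a).
have inA (V : set X) : nbhs z V -> exists a : A, V (set_val a).
  by move=> /clz[x [Ax Vx]]; exists (exist _ x (mem_set Ax)).
have PF : ProperFilter F.
  split; first by move=> [V /inA[a Va] /(_ _ Va)].
  split.
  - by exists setT => //; exact: filterT.
  - move=> S T [V zV VS] [W zW WT]; exists (V `&` W); first exact: filterI.
    by move=> a [Va Wa]; split; [exact: VS|exact: WT].
  - by move=> S T ST [V zV VS]; exists V => // a /VS/ST.
have [l Fl] : exists l : M, F --> l.
  apply: Mcomplete; apply/(cauchy_ballP F) => e e0.
  have [n ne] := half_expn_lt e0.
  have [U [oU Usm] Uz] := zQ n I.
  have FU : F [set h a | a in [set a | U (set_val a)]].
    exists U; last by move=> a Ua; exists a.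
    exact: open_nbhs_nbhs.
  exists ([set h a | a in [set a | U (set_val a)]],
    [set h a | a in [set a | U (set_val a)]]) => //.
  move=> [_ _] [/= [a Ua <-] [b Ub <-]].
  by apply: (le_ball (ltW ne)); exact: Usm.
(* Every neighbourhood of [z] meets every neighbourhood of [g l], the limit brought back to [A]. *)
suff -> : z = set_val (g l) by exact: set_valP.
apply: hX => U V zU gV.
have /Fl[W zW WV] : nbhs l [set m | V (set_val (g m))].
  exact: (gc l _ (@initial_continuous A X set_val (g l) V gV)).
have [a [Ua Wa]] := inA _ (filterI zU zW).
by exists (set_val a); split=> //; rewrite -[a]hg; exact: WV.
Qed.

(** [A] is its closure minus countably many closed sets. Separability confines the entries to a
    countable set, so these closed sets have Borel images, and injectivity lets the difference pass
    through [f]. *)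
Lemma borel_image_polish (R : realType) (K : choiceType) (M : topologicalType)
    (f : omega_power K -> M) (A : set (omega_power K)) :
  hausdorff_space M -> continuous f -> injective f -> polish R A ->
  borel_set (f @` A).
Proof.
move=> hM fc finj [[D cD dD] mA].
have sM := @borel_sigma_algebra M.
have hK : hausdorff_space (omega_power K).
  by apply: hausdorff_product => i; exact: discrete_hausdorff.
have [Q oQ AE] := completely_metrizable_Gdelta hK mA.
pose N := \bigcup_i [set (set_val d : omega_power K) i | d in D].
have cN : countable N.
  apply: bigcup_countable => // i _.
  by apply: sub_countable cD; exact: card_image_le.
(* The sequences with [i]-th entry [x i] form a neighbourhood of [x]; it meets [A], hence the dense
   set [D]. *)
have coordN x i : closure A x -> N (x i).
  move=> clx.
  have cylx (y : omega_power K) : nbhs y [set w : omega_power K | w i = y i].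
    by apply/nbhs_omega_power; exists i.+1 => w yw; rewrite /= yw.
  have [y [Ay yx]] := clx _ (cylx x).
  pose a : A := exist _ y (mem_set Ay).
  have : nbhs a [set b : A | (set_val b : omega_power K) i = y i].
    exact: (@initial_continuous A _ set_val a _ (cylx y)).
  rewrite nbhsE => -[U [oU Ua] Uy].
  have [d [Ud Dd]] := dD U (ex_intro _ a Ua) oU.
  by exists i => //; exists d => //; rewrite (Uy _ Ud).
have bcl (C : set (omega_power K)) :
    closed C -> C `<=` closure A -> borel_set (f @` C).
  move=> Ccl CA; apply: (borel_image_closed hM fc finj Ccl cN) => x i /CA.
  exact: coordN.
rewrite (_ : f @` A = f @` closure A `&`
    \bigcap_n ~` (f @` (closure A `&` ~` Q n))).
  apply: (sigma_algebra_setI sM); first by apply: bcl => //; exact: closed_closure.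
  apply: (sigma_algebra_bigcap_countType sM) => n.
  apply: (sigma_algebra_setC sM); apply: bcl; last by move=> ? [].
  by apply: closedI; [exact: closed_closure|exact: open_closedC].
apply/seteqP; split=> [_ [x Ax <-]|_ [[x clx <-] nQ]].
  have := Ax; rewrite {1}AE => -[clx Qx]; split; first by exists x.
  by move=> n _ [y [_ nQy] /finj yx]; apply: nQy; rewrite yx; exact: Qx.
exists x => //; rewrite AE; split=> // n _; apply: contrapT => nQx.
by apply: (nQ n I); exists x.
Qed.

(** Parity of entries maps the Baire space onto the Cantor space, which maps onto every nonempty
    compact metric space. *)
Lemma omega_power_nat_surj (R : realType) (M : metricType R) :
  compact [set: M] -> [set: M] !=set0 ->
  exists2 q : omega_power nat -> M, continuous q & forall m, exists x, q x = m.
Proof.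
move=> Mc [m0 _].
pose Mp : pseudoPMetricType R := HB.pack M (isPointed.Build M m0).
have [c cc] := @cantor_surj R Mp Mc (@metric_hausdorff R M).
pose w (x : omega_power nat) : cantor_space := fun i => odd (x i).
have wc : continuous w.
  move=> x; apply/cvg_sup => i V [W [[Q oQ <-] Qx QV]].
  apply: filterS QV _; apply/nbhs_omega_power; exists i.+1 => y xy.
  by rewrite /= /w -xy.
exists (c \o w : omega_power nat -> M).
  by move=> x; apply: continuous_comp; [exact: wc|exact: cc].
move=> m; have [z _ zm] := @surj _ _ _ _ c m I.
exists (fun i => z i : nat); rewrite /= -zm; congr (c _).
by apply/funext => i; rewrite /w oddb.
Qed.

Lemma partition_preimage (T U : Type) (P : set (set U)) (f : T -> U) :
  (forall u, exists t, f t = u) -> partition P id setT ->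
  partition [set f @^-1` A | A in P] id setT.
Proof.
move=> fsurj [Pcov Pdisj P0]; split.
- apply/seteqP; split=> // t _.
  have : cover P id (f t) by rewrite Pcov.
  by move=> [A PA At]; exists (f @^-1` A) => //; exists A.
- move=> _ _ [A PA <-] [B PB <-] [t [At Bt]]; congr (f @^-1` _).
  by apply: Pdisj => //; exists (f t).
- move=> _ [A PA <-]; have [u Au] := P0 _ PA; have [t tu] := fsurj u.
  by exists t; rewrite /= tu.
Qed.

Lemma condensation_sp_borel (R : realType) (K : choiceType) (M : metricType R)
    (P : set (set (omega_power K))) (f : omega_power K -> M) :
  ~ countable [set: K] -> polish_partition R P -> P #= [set: K] ->
  compact [set: M] -> continuous f -> bijective f -> sp_borel R K.
Proof.
move=> Kunc [Ppart Ppol] PK Mc fc fbij.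
have [fi ffi fif] := fbij.
have [k0 _] : [set: K] !=set0.
  by apply/set0P/eqP => K0; apply: Kunc; rewrite K0; exact: countable0.
have [q qc qsurj] := omega_power_nat_surj Mc (ex_intro _ (f (fun=> k0)) I).
have [v uv vu] := @real_of_seq_bij R.
pose psi r : omega_power K := fi (q (v r)).
have psi_surj x : exists r, psi r = x.
  have [y yx] := qsurj (f x); exists (real_of_seq R y).
  by rewrite /psi uv yx ffi.
(* Taking preimages along a surjection is injective, so the number of pieces is kept. *)
have P'K : [set psi @^-1` A | A in P] #= P.
  apply: inj_card_eq => A B _ _ AB; apply/seteqP; split=> x; have [r <-] := psi_surj x.
    by move=> Ar; have : (psi @^-1` A) r by []; rewrite AB.
  by move=> Br; have : (psi @^-1` B) r by []; rewrite -AB.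
exists [set psi @^-1` A | A in P]; split.
- exact: partition_preimage.
- move=> _ [A PA <-].
  (* The inverse [v] need not be continuous, but a preimage under [v] is an image under
     [real_of_seq], which preserves Borel sets. *)
  rewrite (_ : psi @^-1` A = @real_of_seq R @` (q @^-1` (f @` A))).
    apply: borel_real_of_seq_image; apply: borel_preimage => //.
    by apply: borel_image_polish (Ppol A PA) => //; [exact: metric_hausdorff|exact: bij_inj].
  apply/seteqP; split=> [r Ar|_ [y [x Ax xy] <-]].
    by exists (v r) => //; exists (psi r) => //; rewrite /psi fif.
  by rewrite /= /psi uv -xy ffi.
- by rewrite (eq_countable P'K) (eq_countable PK).
- exact: card_eq_trans P'K PK.
Qed.

Theorem theorem4p7 (R : realType) (K : choiceType)
    (K_uncountable : ~ countable [set: K])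
    (par_K : par_eq R (omega_power K) K) :
  [<-> sp_borel R K;
       exists2 f : omega_power K -> R, continuous f & bijective f;
       exists2 M : metricType R, compact [set: M] &
         exists2 f : omega_power K -> M, continuous f & bijective f].
Proof.
tfae.
- exact: sp_borel_condensation.
- move=> [f fc fbij]; exists (looped_line R); first exact: looped_line_compact.
  exists (f : omega_power K -> looped_line R); last exact: fbij.
  by move=> x U /looped_line_continuous; exact: fc.
- move=> [M Mc [f fc fbij]]; have [[P Ppol PK] _] := par_K.
  exact: condensation_sp_borel K_uncountable Ppol PK Mc fc fbij.
Qed.
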